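(* Let $q$ be a complex number with $0<|q|<1$, let $N\ge 0$ be an integer, and let $A,B,C,D,E$ be nonzero complex numbers such that all denominators below are nonzero. For nonzero complex $A',C'$ define the truncated very-well-poised ${}_6\psi_6$ series $$\mathbf{S}_N(A';C'):=\sum_{n=-N}^{N} \frac{1-BDEq^{2n+1}/A'}{1-BDEq/A'}\,\frac{(Bq,\,Dq,\,Eq,\,BC'DEq^2/A'^2;q)_n}{(DEq/A',\,BEq/A',\,BDq/A',\,A'/C';q)_n}\Big(\frac{1}{C'q^2}\Big)^n,$$ where $B,D,E$ are kept fixed. Then $$\mathbf{S}_{N+1}(A;C)=\frac{K_N(A;B,C,D,E)}{(Cq^3)^{N}}+\frac{A^2q}{BDE}\,\frac{\nabla(BDE/A,\,Cq^3,\,BD/A,\,BE/A,\,DE/A)}{\nabla(BDEq/A,\,BCDEq/A^2,\,Aq/B,\,Aq/D,\,Aq/E)}\,\mathbf{S}_{N}(Aq;Cq),$$ where $$\begin{aligned}K_N(A;B,C,D,E):=&\ \frac{q^{N-2}\,\nabla(BDEq^{2N+3}/A)\,(Bq,Dq,Eq,BCDEq^2/A^2;q)_{N+1}}{C\,\nabla(BDEq/A)\,(A/C,BDq/A,BEq/A,DEq/A;q)_{N+1}}\\ &+\frac{BDE\,\nabla(q^{N-1}/A)\,(A/(BD),A/(BE),A/(DE),C/A;q)_{N+2}}{C\,\nabla(C/A,Aq/B,Aq/D,Aq/E,BDEq/A)\,(1/B,1/D,1/E,A^2/(BCDEq);q)_{N+1}}\\ &-\frac{A^2q}{BDE}\,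\frac{\nabla(Bq,Dq,Eq,BDEq^{N-1}/A^2)\,(BCDEq^2/A^2,Bq^2,Dq^2,Eq^2;q)_{N}}{\nabla(Aq/B,Aq/D,Aq/E,BDEq/A)\,(A/C,BDq/A,BEq/A,DEq/A;q)_{N}}.\end{aligned}$$
   Context: Notation: $\nabla(x):=1-x$ and $\nabla(x_1,\dots,x_n):=\prod_{i=1}^n(1-x_i)$. The $q$-shifted factorial is $(a;q)_n=(1-a)(1-aq)\cdots(1-aq^{n-1})$ for $n\ge1$, $(a;q)_0=1$, and $(a;q)_n=\big((1-aq^{-1})(1-aq^{-2})\cdots(1-aq^{n})\big)^{-1}$ for $n\le -1$; also $(x_1,\dots,x_m;q)_n:=\prod_{i=1}^m(x_i;q)_n$. In the statement, $\mathbf{S}_N(Aq;Cq)$ denotes the defined sum with $A'=Aq$, $C'=Cq$ and the same $B,D,E$. *)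

(* Defs.v *)
From HB Require Import structures.
From mathcomp Require Export all_boot all_order all_algebra.
From mathcomp Require Export reals complex.

Set Implicit Arguments.
Unset Strict Implicit.
Unset Printing Implicit Defensive.

Import Order.TTheory GRing.Theory Num.Theory.
Local Open Scope ring_scope.

Definition nabla (F : fieldType) (x : F) : F := 1 - x.

Definition nablas (F : fieldType) (xs : seq F) : F := \prod_(x <- xs) nabla x.

(* The denominator occurring in the definition of (a;q)_n: empty for n >= 0,
   (1 - a q^-1) ... (1 - a q^n) for n <= -1; recall Negz m = - (m + 1). *)
Definition qfact_den (F : fieldType) (q a : F) (n : int) : F :=
  match n with
  | Posz _ => 1
  | Negz m => \prod_(i < m.+1) (1 - a * q ^- i.+1)
  end.

Definition qfact (F : fieldType) (q a : F) (n : int) : F :=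
  match n with
  | Posz m => \prod_(i < m) (1 - a * q ^+ i)
  | Negz _ => (qfact_den q a n)^-1
  end.

Definition qfacts (F : fieldType) (q : F) (xs : seq F) (n : int) : F :=
  \prod_(x <- xs) qfact q x n.

Definition truncS_upper (F : fieldType) (q B D E A C : F) : seq F :=
  [:: B * q; D * q; E * q; B * C * D * E * q ^+ 2 / A ^+ 2].

Definition truncS_lower (F : fieldType) (q B D E A C : F) : seq F :=
  [:: D * E * q / A; B * E * q / A; B * D * q / A; A / C].

Definition truncS_term (F : fieldType) (q B D E A C : F) (n : int) : F :=
  (1 - B * D * E * q ^ (2 * n + 1) / A) / (1 - B * D * E * q / A)
  * (qfacts q (truncS_upper q B D E A C) n / qfacts q (truncS_lower q B D E A C) n)
  * (1 / (C * q ^+ 2)) ^ n.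

Definition truncS (F : fieldType) (q B D E : F) (N : nat) (A C : F) : F :=
  \sum_(i < (2 * N).+1) truncS_term q B D E A C (i%:Z - N%:Z).

(* All denominators of truncS are nonzero, including those hidden in the q-shifted
   factorials of negative index. Those built only from q, A and C are left out,
   as q, A and C are assumed nonzero wherever this is used. *)
Definition truncS_defined (F : fieldType) (q B D E : F) (N : nat) (A C : F) : Prop :=
  1 - B * D * E * q / A != 0 /\
  forall n : int, - N%:Z <= n <= N%:Z ->
    (forall x, x \in truncS_upper q B D E A C ++ truncS_lower q B D E A C ->
       qfact_den q x n != 0) /\
    qfacts q (truncS_lower q B D E A C) n != 0.

Definition K_den1 (F : fieldType) (q : F) (N : nat) (A B C D E : F) : F :=
  C * nabla (B * D * E * q / A)
  * qfacts q [:: A / C; B * D * q / A; B * E * q / A; D * E * q / A] N.+1.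

Definition K_den2 (F : fieldType) (q : F) (N : nat) (A B C D E : F) : F :=
  C * nablas [:: C / A; A * q / B; A * q / D; A * q / E; B * D * E * q / A]
  * qfacts q [:: 1 / B; 1 / D; 1 / E; A ^+ 2 / (B * C * D * E * q)] N.+1.

Definition K_den3 (F : fieldType) (q : F) (N : nat) (A B C D E : F) : F :=
  nablas [:: A * q / B; A * q / D; A * q / E; B * D * E * q / A]
  * qfacts q [:: A / C; B * D * q / A; B * E * q / A; D * E * q / A] N.

Definition K (F : fieldType) (q : F) (N : nat) (A B C D E : F) : F :=
  q ^ (N%:Z - 2) * nabla (B * D * E * q ^+ (2 * N + 3) / A)
    * qfacts q [:: B * q; D * q; E * q; B * C * D * E * q ^+ 2 / A ^+ 2] N.+1
    / K_den1 q N A B C D E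
  + B * D * E * nabla (q ^ (N%:Z - 1) / A)
    * qfacts q [:: A / (B * D); A / (B * E); A / (D * E); C / A] N.+2
    / K_den2 q N A B C D E
  - A ^+ 2 * q / (B * D * E)
    * (nablas [:: B * q; D * q; E * q; B * D * E * q ^ (N%:Z - 1) / A ^+ 2]
       * qfacts q [:: B * C * D * E * q ^+ 2 / A ^+ 2;
                      B * q ^+ 2; D * q ^+ 2; E * q ^+ 2] N
       / K_den3 q N A B C D E).

Definition K_defined (F : fieldType) (q : F) (N : nat) (A B C D E : F) : Prop :=
  [/\ K_den1 q N A B C D E != 0, K_den2 q N A B C D E != 0
    & K_den3 q N A B C D E != 0].

(* Main.v *)
(** Write t_n for the n-th term of S(A; C), t'_n for that of S(Aq; Cq) and c for
    the coefficient of S_N(Aq; Cq).  The difference t_n - c t'_n telescopes: it is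
    H_(n-1) - H_n, where H_n is the third summand of K_n divided by (C q^3)^n,
    continued to all integers n.  Summing over -N <= n <= N leaves H_(-N-1) - H_N;
    the outer term t_(N+1) is the first summand of K_N, and t_(-N-1) + H_(-N-1) is
    the second one after the reflection of (a; q)_(-n) into (1/a; q)_n. *)
Require Import Defs.
From mathcomp Require Import ring zify.
Import Order.TTheory GRing.Theory Num.Theory.
Local Open Scope ring_scope.

(** * Shifted factorials at an integer index *)

(** For n >= 1 this splits off the last factor. For n <= 0 the factor 1 - a q^(n-1) is the last one
    in the denominator at n - 1 and has to cancel there, hence the hypothesis at n - 1. *)
Lemma qfact_rec {F : fieldType} (q a : F) (n : int) :
  qfact_den q a (n - 1) != 0 ->
  qfact q a n = qfact q a (n - 1) * (1 - a * q ^ (n - 1)).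
Proof.
case: n => [[|m]|m].
- rewrite sub0r /= !big_ord1 big_ord0 => h.
  by rewrite mulVf.
- have -> : m.+1%:Z - 1 = m by lia.
  by rewrite /= big_ord_recr.
- have -> : Negz m - 1 = Negz m.+1 by rewrite !NegzE; lia.
  rewrite /qfact /qfact_den big_ord_recr /= mulf_eq0 negb_or => /andP[h1 h2].
  by rewrite invfM mulfVK.
Qed.

Lemma qfactS {F : fieldType} (q a : F) (n : nat) :
  qfact q a n.+1 = (1 - a) * qfact q (a * q) n.
Proof.
rewrite /= big_ord_recl expr0 mulr1; congr (_ * _).
by apply: eq_bigr => i _; rewrite -mulrA -exprS.
Qed.

(** Peels at the front, where [qfact_rec] peels at the end. For n <= 0 the factor 1 - a opens the
    denominator of (aq; q)_(n-1), because aq q^(-1) = a. This is how factorials of S(Aq; Cq) are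
    compared with those of S(A; C). *)
Lemma qfact_shift {F : fieldType} {q a : F} (n : int) : q != 0 -> 1 - a != 0 ->
  qfact q a n = (1 - a) * qfact q (a * q) (n - 1).
Proof.
move=> q0; case: n => [[|m]|m] ha.
- rewrite sub0r /= !big_ord1 big_ord0 expr1.
  by rewrite mulfK // mulfV.
- have -> : m.+1%:Z - 1 = m by lia.
  exact: qfactS.
- have -> : Negz m - 1 = Negz m.+1 by rewrite !NegzE; lia.
  rewrite /qfact /qfact_den [in RHS]big_ord_recl expr1 mulfK //.
  rewrite invfM mulrA mulfV // mul1r; congr (_^-1).
  apply: eq_bigr => i _; rewrite lift0 [in RHS]exprS; field.
  by rewrite q0 expf_neq0.
Qed.

(** Factor by factor, 1 - q^i / a = (- q^i / a) (1 - a q q^(-i-1)), and the last factors form the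
    denominator of (aq; q)_(-n). *)
Lemma qfact_reflection {F : fieldType} (q a : F) (n : nat) :
  q != 0 -> a != 0 ->
  qfact q a^-1 n = \prod_(i < n) (- q ^+ i) / a ^+ n / qfact q (a * q) (- n%:Z).
Proof.
move=> q0 a0; case: n => [|n].
  by rewrite oppr0 /= !big_ord0 expr0 !divr1.
rewrite -NegzE /qfact /qfact_den invrK.
rewrite -exprVn -[X in a^-1 ^+ X]card_ord -prodr_const -!big_split /=.
apply: eq_bigr => i _; rewrite exprS; field.
by rewrite q0 a0 expf_neq0.
Qed.

(** * The two rational identities behind the summation *)

(** With x = q^n, this is what remains of t_n - c t'_n = H_(n-1) - H_n once the common factor of the
    four terms is removed. *)
Lemma step_identity {F : fieldType} {q : F} (x : F) {A B C D E : F} :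
  q != 0 -> A != 0 -> B != 0 -> C != 0 -> D != 0 -> E != 0 ->
  x * (1 - B * D * E * q * x ^+ 2 / A) * (1 - B * C * D * E * q * x / A ^+ 2)
   * ((1 - A * q / B) * (1 - A * q / D) * (1 - A * q / E)) * (B * D * E / (A ^+ 2 * q))
  - (1 - C * q ^+ 3) * (1 - B * D * E * x ^+ 2 / A)
    * ((1 - D * E * x / A) * (1 - B * E * x / A) * (1 - B * D * x / A))
  = (1 - B * D * E * x / (q ^+ 2 * A ^+ 2)) * (C * q ^+ 3 * (1 - A * x / (C * q)))
    * ((1 - D * E * x / A) * (1 - B * E * x / A) * (1 - B * D * x / A))
    - (1 - B * D * E * x / (q * A ^+ 2))
    * ((1 - B * q * x) * (1 - D * q * x) * (1 - E * q * x))
    * (1 - B * C * D * E * q * x / A ^+ 2).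
Proof.
move=> q0 A0 B0 C0 D0 E0; field.
by rewrite q0 A0 B0 C0 D0 E0.
Qed.

(** With y = q^(N+1), this is what remains of t_(-N-1) + H_(-N-1). The three factors ending the
    right side are the last factors of the factorials of order N + 2 in K_N. *)
Lemma boundary_identity {F : fieldType} {q y A B D E : F} :
  q != 0 -> y != 0 -> A != 0 -> B != 0 -> D != 0 -> E != 0 ->
  y ^+ 2 * (1 - B * D * E * q / (A * y ^+ 2))
   * ((1 - A * q / B) * (1 - A * q / D) * (1 - A * q / E))
  + A ^+ 2 * q / (B * D * E) * (1 - B * D * E / (A ^+ 2 * q * y))
    * ((1 - B * q / y) * (1 - D * q / y) * (1 - E * q / y)) * y ^+ 3
  = B * D * E * q ^+ 3 / y * (1 - y / (q ^+ 2 * A))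
    * ((1 - A * y / (B * D)) * (1 - A * y / (B * E)) * (1 - A * y / (D * E))).
Proof.
move=> q0 y0 A0 B0 D0 E0; field.
by rewrite q0 y0 A0 B0 D0 E0.
Qed.

(** * The telescoping relation *)

(* H_n of the header; it enters K with a minus sign. *)
Definition primitive {F : fieldType} (q A B C D E : F) (n : int) : F :=
  A ^+ 2 * q / (B * D * E)
  * ((1 - B * D * E * q ^ (n - 1) / A ^+ 2)
     * (qfacts q [:: B * q; D * q; E * q] (n + 1)
        * qfact q (B * C * D * E * q ^+ 2 / A ^+ 2) n)
     / (nablas [:: A * q / B; A * q / D; A * q / E; B * D * E * q / A]
        * qfacts q (truncS_lower q B D E A C) n))
  * (1 / (C * q ^+ 3)) ^ n.

Definition contiguity_coef {F : fieldType} (q A B C D E : F) : F :=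
  A ^+ 2 * q / (B * D * E)
  * (nablas [:: B * D * E / A; C * q ^+ 3; B * D / A; B * E / A; D * E / A]
     / nablas [:: B * D * E * q / A; B * C * D * E * q / A ^+ 2;
                  A * q / B; A * q / D; A * q / E]).

Lemma truncS_term_telescope {F : fieldType} (q A B C D E : F) (n : int) :
  q != 0 -> A != 0 -> B != 0 -> C != 0 -> D != 0 -> E != 0 ->
  (forall x, x \in truncS_upper q B D E A C ++ truncS_lower q B D E A C ->
     qfact_den q x (n - 1) != 0 /\ qfact_den q x n != 0) ->
  qfacts q (truncS_lower q B D E A C) (n - 1) != 0 ->
  qfacts q (truncS_lower q B D E A C) n != 0 ->
  nablas [:: B * D * E / A; B * D / A; B * E / A; D * E / A] != 0 ->
  nablas [:: B * D * E * q / A; B * C * D * E * q / A ^+ 2;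
             A * q / B; A * q / D; A * q / E] != 0 ->
  truncS_term q B D E A C n
  - contiguity_coef q A B C D E * truncS_term q B D E (A * q) (C * q) n
  = primitive q A B C D E (n - 1) - primitive q A B C D E n.
Proof.
move=> q0 A0 B0 C0 D0 E0 hden.
rewrite /truncS_term /contiguity_coef /primitive /qfacts /truncS_upper /truncS_lower.
rewrite /nablas /nabla !big_cons !big_nil !mulr1.
have x0 : q ^ n != 0 by rewrite expfz_neq0.
(* All factorials are brought to common indices: n for the parameters Bq, Dq, Eq, and n - 1 for all
   others. *)
have up (a : F) : qfact_den q (a * q) n != 0 ->
    qfact q (a * q) (n + 1) = qfact q (a * q) n * (1 - a * q * q ^ n).
  by move=> h; rewrite qfact_rec addrK.
have dn (a : F) : qfact_den q a (n - 1) != 0 ->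
    qfact q a n = qfact q a (n - 1) * (1 - a / q * q ^ n).
  by move=> h; rewrite qfact_rec // expfzDr // exprN1; congr (_ * (_ - _)); field.
have [|_ hB] := hden (B * q); first by rewrite !inE eqxx.
have [|_ hD] := hden (D * q); first by rewrite !inE eqxx !orbT.
have [|_ hE] := hden (E * q); first by rewrite !inE eqxx !orbT.
have [|hU _] := hden (B * C * D * E * q ^+ 2 / A ^+ 2).
  by rewrite !inE eqxx !orbT.
have [|hDE _] := hden (D * E * q / A); first by rewrite !inE eqxx !orbT.
have [|hBE _] := hden (B * E * q / A); first by rewrite !inE eqxx !orbT.
have [|hBD _] := hden (B * D * q / A); first by rewrite !inE eqxx !orbT.
have [|hAC _] := hden (A / C); first by rewrite !inE eqxx !orbT.
rewrite subrK !up // (dn _ hU) (dn _ hDE) (dn _ hBE) (dn _ hBD) (dn _ hAC).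
rewrite !mulf_eq0 !negb_or => /and4P[l1 l2 l3 l4].
rewrite l1 l2 l3 l4 /= => /and4P[p1 p2 p3 p4].
move=> /and4P[v1 m3 m2 m1] /and5P[v0 s n1 n2 n3].
(* In t'_n the parameter A/C is unchanged and the other parameters containing A lose a factor q.
   [qfact_shift] restores them at index n - 1, and the factors it splits off cancel against
   [contiguity_coef]. *)
have -> : B * (C * q) * D * E * q ^+ 2 / (A * q) ^+ 2
   = B * C * D * E * q / A ^+ 2 by field; rewrite q0 A0.
have -> : A * q / (C * q) = A / C by field; rewrite q0 C0.
have cancel (b : F) : b * q / (A * q) = b / A by field; rewrite q0 A0.
rewrite !cancel (dn _ hAC).
rewrite (qfact_shift _ q0 m1) (qfact_shift _ q0 m2) (qfact_shift _ q0 m3).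
rewrite (qfact_shift _ q0 s).
have e (b : F) : b / A * q = b * q / A by field.
rewrite !e.
have -> : B * C * D * E * q / A ^+ 2 * q = B * C * D * E * q ^+ 2 / A ^+ 2 by field.
have r (b : F) : b * q / A / q * q ^ n = b * q ^ n / A.
  by field; rewrite q0 A0.
have rU : B * C * D * E * q ^+ 2 / A ^+ 2 / q * q ^ n
    = B * C * D * E * q * q ^ n / A ^+ 2 by field; rewrite q0 A0.
have rAC : A / C / q * q ^ n = A * q ^ n / (C * q) by field; rewrite q0 C0.
have q2n : q ^ (2 * n + 1) = q * (q ^ n) ^+ 2.
  by rewrite expfzDr // expr1z mulrC [2 * n]mulrC -exprz_exp.
have r1 : B * D * E * q ^ (2 * n + 1) / A = B * D * E * q * (q ^ n) ^+ 2 / A.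
  by rewrite q2n; field.
have r2 : B * D * E * q ^ (2 * n + 1) / (A * q) = B * D * E * (q ^ n) ^+ 2 / A.
  by rewrite q2n; field; rewrite q0 A0.
have r3 : B * D * E * q ^ (n - 1) / A ^+ 2 = B * D * E * q ^ n / (q * A ^+ 2).
  by rewrite expfzDr // exprN1; field; rewrite q0 A0.
have r4 : B * D * E * q ^ (n - 1 - 1) / A ^+ 2
    = B * D * E * q ^ n / (q ^+ 2 * A ^+ 2).
  by rewrite !expfzDr // exprN1; field; rewrite q0 A0.
(* The ratio 1/(C q^3) of t'_n is also that of H_n, so every power reduces to (1/(C q^2))^n and
   q^n. *)
have w1 : (1 / (C * q * q ^+ 2)) ^ n = (1 / (C * q ^+ 2)) ^ n / q ^ n.
  by rewrite expfV -expfzMl; congr (_ ^ n); field; rewrite q0 C0.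
have Cq : C * q * q ^+ 2 = C * q ^+ 3 by ring.
have w2 : (1 / (C * q ^+ 3)) ^ n = (1 / (C * q ^+ 2)) ^ n / q ^ n.
  by rewrite -Cq.
have w3 : (1 / (C * q ^+ 3)) ^ (n - 1)
    = (1 / (C * q ^+ 2)) ^ n / q ^ n * (C * q ^+ 3).
  rewrite expfzDr ?w2; last by rewrite mul1r invr_neq0 // mulf_neq0 ?expf_neq0.
  by congr (_ * _); rewrite exprN1 mul1r invrK.
rewrite r1 r2 r3 r4 w1 w2 w3 !r rU rAC.
move: p1 p2 p3 p4; rewrite !r rAC => p1 p2 p3 p4.
move: (step_identity (q ^ n) q0 A0 B0 C0 D0 E0).
(* Every factor becomes an independent variable, so that [field] never expands it; [step_identity]
   is the only relation kept between them. *)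
move: (1 - D * E * q ^ n / A) p1 => P1 p1.
move: (1 - B * E * q ^ n / A) p2 => P2 p2.
move: (1 - B * D * q ^ n / A) p3 => P3 p3.
move: (1 - A * q ^ n / (C * q)) p4 => P4 p4.
move: (1 - B * D * E / A) v1 => V1 v1.
move: (1 - B * D * E * q / A) v0 => V0 v0.
move: (1 - B * C * D * E * q / A ^+ 2) s => S s.
move: (1 - D * E / A) m1 => M1 m1.
move: (1 - B * E / A) m2 => M2 m2.
move: (1 - B * D / A) m3 => M3 m3.
move: (1 - A * q / B) n1 => N1 n1.
move: (1 - A * q / D) n2 => N2 n2.
move: (1 - A * q / E) n3 => N3 n3.
move: (qfact q (D * E * q / A) (n - 1)) l1 => L1 l1.
move: (qfact q (B * E * q / A) (n - 1)) l2 => L2 l2.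
move: (qfact q (B * D * q / A) (n - 1)) l3 => L3 l3.
move: (qfact q (A / C) (n - 1)) l4 => L4 l4.
move: (qfact q (B * q) n) (qfact q (D * q) n) (qfact q (E * q) n) => UB UD UE.
move: (qfact q (B * C * D * E * q ^+ 2 / A ^+ 2) (n - 1)) => U.
move: (1 - B * C * D * E * q * q ^ n / A ^+ 2) => f.
move: (1 - B * D * E * q * (q ^ n) ^+ 2 / A) => t1.
move: (1 - B * D * E * (q ^ n) ^+ 2 / A) => t2.
move: (1 - B * D * E * q ^ n / (q * A ^+ 2)) => h1.
move: (1 - B * D * E * q ^ n / (q ^+ 2 * A ^+ 2)) => h2.
move: (1 - B * q * q ^ n) (1 - D * q * q ^ n) (1 - E * q * q ^ n) => RB RD RE.
move: (1 - C * q ^+ 3) ((1 / (C * q ^+ 2)) ^ n) => Z w.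
move: (q ^ n) x0 => x x0.
move=> id.
clear -id q0 A0 B0 C0 D0 E0 p1 p2 p3 p4 v1 v0 s m1 m2 m3 n1 n2 n3 l1 l2 l3 l4 x0.
(* G is what the four sides have in common; what remains is [step_identity]. *)
pose G := A ^+ 2 * q / (B * D * E) * (UB * UD * UE * U)
  / (N1 * N2 * N3 * V0 * (L1 * P1 * (L2 * P2) * (L3 * P3) * (L4 * P4))) * (w / x).
transitivity (G * (x * t1 * f * (N1 * N2 * N3) * (B * D * E / (A ^+ 2 * q))
   - Z * t2 * (P1 * P2 * P3))).
  rewrite /G; field.
  by rewrite x0 q0 l1 l2 l3 l4 m1 m2 m3 s n1 n2 n3 A0 v1 v0 p1 p2 p3 p4 B0 D0 E0.
rewrite id /G; field.
by rewrite x0 l1 l2 l3 l4 n1 n2 n3 v0 p1 p2 p3 p4 B0 D0 E0.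
Qed.

(** * The three summands of K_N as boundary terms *)

Lemma boundary_term {F : fieldType} {q : F} {N : nat} {A B C D E : F} :
  q != 0 -> A != 0 -> B != 0 -> C != 0 -> D != 0 -> E != 0 ->
  (forall x, x \in truncS_upper q B D E A C ++ truncS_lower q B D E A C ->
     qfact_den q x (- N.+1%:Z) != 0) ->
  K_den2 q N A B C D E != 0 ->
  truncS_term q B D E A C (- N.+1%:Z) + primitive q A B C D E (- N.+1%:Z)
  = B * D * E * nabla (q ^ (N%:Z - 1) / A)
    * qfacts q [:: A / (B * D); A / (B * E); A / (D * E); C / A] N.+2
    / K_den2 q N A B C D E / (C * q ^+ 3) ^+ N.
Proof.
have predN2 : N.+2%:Z - 1 = N.+1 by lia.
move=> q0 A0 B0 C0 D0 E0 hden.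
rewrite /K_den2 /truncS_term /primitive /qfacts /truncS_upper /truncS_lower.
rewrite /nablas /nabla !big_cons !big_nil !mulr1.
have y0 : q ^+ N.+1 != 0 by rewrite expf_neq0.
(* Each reflection produces this product. It occurs four times above and four times below the
   fraction bar, so it cancels and is never evaluated. *)
have s0 : \prod_(i < N.+1) (- q ^+ i) != 0.
  by apply/prodf_neq0 => i _; rewrite oppr_eq0 expf_neq0.
have qneg : q ^ (- N.+1%:Z) = (q ^+ N.+1)^-1 by [].
have up (a : F) : qfact_den q a (- N.+1%:Z) != 0 ->
    qfact q a (- N.+1%:Z + 1) = qfact q a (- N.+1%:Z) * (1 - a / q ^+ N.+1).
  by move=> h; rewrite qfact_rec addrK.
(* At a negative index the factorial is the inverse of its denominator. *)
have nz (a : F) : qfact_den q a (- N.+1%:Z) != 0 -> qfact q a (- N.+1%:Z) != 0.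
  by rewrite -NegzE => h; rewrite invr_neq0.
have hB : qfact_den q (B * q) (- N.+1%:Z) != 0 by apply: hden; rewrite !inE eqxx.
have hD : qfact_den q (D * q) (- N.+1%:Z) != 0.
  by apply: hden; rewrite !inE eqxx !orbT.
have hE : qfact_den q (E * q) (- N.+1%:Z) != 0.
  by apply: hden; rewrite !inE eqxx !orbT.
have /nz hU : qfact_den q (B * C * D * E * q ^+ 2 / A ^+ 2) (- N.+1%:Z) != 0.
  by apply: hden; rewrite !inE eqxx !orbT.
have /nz l1 : qfact_den q (D * E * q / A) (- N.+1%:Z) != 0.
  by apply: hden; rewrite !inE eqxx !orbT.
have /nz l2 : qfact_den q (B * E * q / A) (- N.+1%:Z) != 0.
  by apply: hden; rewrite !inE eqxx !orbT.
have /nz l3 : qfact_den q (B * D * q / A) (- N.+1%:Z) != 0.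
  by apply: hden; rewrite !inE eqxx !orbT.
have /nz l4 : qfact_den q (A / C) (- N.+1%:Z) != 0.
  by apply: hden; rewrite !inE eqxx !orbT.
rewrite !up //; move/nz: hB => hB; move/nz: hD => hD; move/nz: hE => hE.
rewrite !mulf_eq0 !negb_or => /andP[/andP[_ /and5P[ac n1 n2 n3 v0]] _].
(* (C/A; q)_(N+2) loses its first factor, which cancels the 1 - C/A of [K_den2]; the other three
   factorials of order N + 2 lose their last one. All then have order N + 1, ready for
   reflection. *)
rewrite (qfact_shift N.+2 q0 ac) predN2.
have recr (a : F) : qfact q a N.+2 = qfact q a N.+1 * (1 - a * q ^+ N.+1).
  by rewrite /= big_ord_recr.
rewrite !recr.
(* Reflection with c = 1/b and z = bq given separately, so that both sides match the parameters
   exactly as they are written in K_N and in t_(-N-1). *)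
have refl (b c z : F) : b != 0 -> b * c = 1 -> b * q = z ->
   qfact q c N.+1 = \prod_(i < N.+1) (- q ^+ i) / b ^+ N.+1
                    / qfact q z (- N.+1%:Z).
  move=> b0 bc <-; rewrite -qfact_reflection //; congr (qfact q _ _).
  by rewrite -[LHS]mul1r -(mulVf b0) -mulrA bc mulr1.
have unit := (mulf_neq0, invr_neq0, expf_neq0).
rewrite (refl (B * D / A) (A / (B * D)) (B * D * q / A)); first last.
- by field.
- by field; rewrite A0 B0 D0.
- by rewrite !unit.
rewrite (refl (B * E / A) (A / (B * E)) (B * E * q / A)); first last.
- by field.
- by field; rewrite A0 B0 E0.
- by rewrite !unit.
rewrite (refl (D * E / A) (A / (D * E)) (D * E * q / A)); first last.
- by field.
- by field; rewrite A0 D0 E0.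
- by rewrite !unit.
rewrite (refl (A / (C * q)) (C / A * q) (A / C)); first last.
- by field; rewrite C0 q0.
- by field; rewrite A0 C0 q0.
- by rewrite !unit.
rewrite (refl B (1 / B) (B * q)) //; last by field.
rewrite (refl D (1 / D) (D * q)) //; last by field.
rewrite (refl E (1 / E) (E * q)) //; last by field.
rewrite (refl (B * C * D * E * q / A ^+ 2) (A ^+ 2 / (B * C * D * E * q))
  (B * C * D * E * q ^+ 2 / A ^+ 2)); first last.
- by field.
- by field; rewrite q0 E0 D0 C0 B0 A0.
- by rewrite !unit.
have r1 : B * D * E * q ^ (2 * - N.+1%:Z + 1) / A
    = B * D * E * q / (A * (q ^+ N.+1) ^+ 2).
  rewrite expfzDr // expr1z [2 * _]mulrC -exprz_exp qneg exprnP -exprnP.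
  by field; rewrite A0 y0.
have r2 : B * D * E * q ^ (- N.+1%:Z - 1) / A ^+ 2
    = B * D * E / (A ^+ 2 * q * q ^+ N.+1).
  by rewrite expfzDr // exprN1 qneg; field; rewrite A0 y0 q0.
have r3 : q ^ (N%:Z - 1) / A = q ^+ N.+1 / (q ^+ 2 * A).
  by rewrite expfzDr // exprN1 -exprnP exprS; field; rewrite A0 q0.
have r4 (b : F) : A / b * q ^+ N.+1 = A * q ^+ N.+1 / b by rewrite mulrAC.
have w1 : (1 / (C * q ^+ 2)) ^ (- N.+1%:Z) = C ^+ N.+1 * (q ^+ N.+1) ^+ 2.
  by rewrite mul1r exprz_inv opprK -exprnP exprMn exprAC.
have w2 : (1 / (C * q ^+ 3)) ^ (- N.+1%:Z) = C ^+ N.+1 * (q ^+ N.+1) ^+ 3.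
  by rewrite mul1r exprz_inv opprK -exprnP exprMn exprAC.
have w3 : (C * q ^+ 3) ^+ N = C ^+ N.+1 * (q ^+ N.+1) ^+ 3 / (C * q ^+ 3).
  by rewrite (exprAC q) -exprMn [_ ^+ N.+1]exprSr mulfK // !unit.
rewrite r1 r2 r3 !r4 w1 w2 w3 !(exprMn, exprVn).
have b0 : B ^+ N.+1 != 0 by rewrite unit.
have d0 : D ^+ N.+1 != 0 by rewrite unit.
have e0 : E ^+ N.+1 != 0 by rewrite unit.
have a0 : A ^+ N.+1 != 0 by rewrite unit.
have c0 : C ^+ N.+1 != 0 by rewrite unit.
move: (boundary_identity q0 y0 A0 B0 D0 E0).
move: (1 - A * q / B) n1 => N1 n1.
move: (1 - A * q / D) n2 => N2 n2.
move: (1 - A * q / E) n3 => N3 n3.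
move: (1 - B * D * E * q / A) v0 => V0 v0.
move: (1 - C / A) ac => ac_ ac.
move: (qfact q (D * E * q / A) _) l1 => L1 l1.
move: (qfact q (B * E * q / A) _) l2 => L2 l2.
move: (qfact q (B * D * q / A) _) l3 => L3 l3.
move: (qfact q (A / C) _) l4 => L4 l4.
move: (qfact q (B * q) _) hB => UB hB.
move: (qfact q (D * q) _) hD => UD hD.
move: (qfact q (E * q) _) hE => UE hE.
move: (qfact q (B * C * D * E * q ^+ 2 / A ^+ 2) _) hU => U hU.
move: (1 - B * D * E * q / (A * (q ^+ N.+1) ^+ 2)) => t.
move: (1 - B * D * E / (A ^+ 2 * q * q ^+ N.+1)) => h.
move: (1 - q ^+ N.+1 / (q ^+ 2 * A)) => k.
move: (1 - B * q / q ^+ N.+1) (1 - D * q / q ^+ N.+1) (1 - E * q / q ^+ N.+1).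
move=> RB RD RE.
move: (1 - A * q ^+ N.+1 / (B * D)) (1 - A * q ^+ N.+1 / (B * E))
  (1 - A * q ^+ N.+1 / (D * E)) => T3 T2 T1.
move: (\prod_(i < N.+1) _) s0 => s s0.
move: (B ^+ N.+1) (D ^+ N.+1) (E ^+ N.+1) b0 d0 e0 => b d e b0 d0 e0.
move: (A ^+ N.+1) (C ^+ N.+1) a0 c0 => a c a0 c0.
move: (q ^+ N.+1) y0 => y y0 id.
clear -id q0 A0 B0 C0 D0 E0 n1 n2 n3 v0 ac l1 l2 l3 l4 hB hD hE hU s0 b0 d0 e0
  a0 c0 y0.
(* The common factor of t_(-N-1) and H_(-N-1); the cofactor is the left side of
   [boundary_identity]. *)
pose G := UB * UD * UE * U / (L1 * L2 * L3 * L4) / (N1 * N2 * N3 * V0) * c.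
transitivity (G * (y ^+ 2 * t * (N1 * N2 * N3)
    + A ^+ 2 * q / (B * D * E) * h * (RB * RD * RE) * y ^+ 3)).
  rewrite /G; field.
  by rewrite l1 l2 l3 l4 n1 n2 n3 v0 B0 D0 E0.
rewrite id /G; field.
by rewrite q0 C0 y0 c0 hU a0 e0 d0 b0 hE hD hB s0 v0 n3 n2 n1 ac l4 l1 l2 l3.
Qed.

(** The factorials agree already; only the power differs, and (C q^2)^(N+1) = C (C q^3)^N q^(2-N)
    accounts for the factor q^(N-2). *)
Lemma truncS_term_K {F : fieldType} {q : F} {N : nat} {A B C D E : F} :
  q != 0 -> C != 0 -> K_den1 q N A B C D E != 0 ->
  truncS_term q B D E A C N.+1
  = q ^ (N%:Z - 2) * nabla (B * D * E * q ^+ (2 * N + 3) / A)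
    * qfacts q [:: B * q; D * q; E * q; B * C * D * E * q ^+ 2 / A ^+ 2] N.+1
    / K_den1 q N A B C D E / (C * q ^+ 3) ^+ N.
Proof.
have e1 : 2 * N.+1%:Z + 1 = (2 * N + 3)%N by lia.
move=> q0 C0; rewrite /K_den1 /truncS_term /truncS_upper /truncS_lower /nabla.
rewrite e1 -exprnP /qfacts !big_cons !big_nil !mulr1.
rewrite !mulf_eq0 !negb_or => /andP[/andP[_ v0] /and4P[l4 l3 l2 l1]].
have w : (1 / (C * q ^+ 2)) ^ N.+1 = q ^ (N%:Z - 2) / (C * (C * q ^+ 3) ^+ N).
  have x k : (C * q ^+ k) ^+ N = C ^+ N * (q ^+ N) ^+ k by rewrite exprMn exprAC.
  rewrite expfzDr // mul1r -!exprnP exprVn exprS !x.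
  rewrite (_ : q ^ (- 2) = (q ^+ 2)^-1) //.
  by field; rewrite !expf_neq0 // C0 q0.
rewrite w; move: (1 - _) => t; move: (1 - _) v0 => V v0.
by field; rewrite expf_neq0 ?mulf_neq0 ?expf_neq0 // l1 l2 l3 l4 v0 C0.
Qed.

(** Both forms agree because (Bq; q)_(N+1) = (1 - Bq) (Bq^2; q)_N, and likewise for D and E. *)
Lemma primitive_K {F : fieldType} {q : F} {N : nat} {A B C D E : F} :
  primitive q A B C D E N
  = A ^+ 2 * q / (B * D * E)
    * (nablas [:: B * q; D * q; E * q; B * D * E * q ^ (N%:Z - 1) / A ^+ 2]
       * qfacts q [:: B * C * D * E * q ^+ 2 / A ^+ 2;
                      B * q ^+ 2; D * q ^+ 2; E * q ^+ 2] N
       / K_den3 q N A B C D E) / (C * q ^+ 3) ^+ N.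
Proof.
have e1 : N%:Z + 1 = N.+1 by lia.
rewrite /K_den3 /primitive /truncS_lower /nablas /nabla /qfacts !big_cons !big_nil.
rewrite !mulr1 e1 !qfactS -!(mulrA _ q q) -!expr2 mul1r -exprnP exprVn.
congr (_ * (_ / _) / _); first by ring.
by congr (_ * _); ring.
Qed.

(** * Summation over -N <= n <= N *)

Theorem theorem2p1 (R : realType) (q : R[i]) (hq : 0 < `|q| < 1) (N : nat)
  (A B C D E : R[i])
  (hA : A != 0) (hB : B != 0) (hC : C != 0) (hD : D != 0) (hE : E != 0)
  (hS1 : truncS_defined q B D E N.+1 A C)
  (hS2 : truncS_defined q B D E N (A * q) (C * q))
  (hK : K_defined q N A B C D E)
  (hcoef : nablas [:: B * D * E * q / A; B * C * D * E * q / A ^+ 2;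
                      A * q / B; A * q / D; A * q / E] != 0) :
  truncS q B D E N.+1 A C =
    K q N A B C D E / (C * q ^+ 3) ^+ N
    + A ^+ 2 * q / (B * D * E)
      * (nablas [:: B * D * E / A; C * q ^+ 3; B * D / A; B * E / A; D * E / A]
         / nablas [:: B * D * E * q / A; B * C * D * E * q / A ^+ 2;
                      A * q / B; A * q / D; A * q / E])
      * truncS q B D E N (A * q) (C * q).
Proof.
have e0 : (2 * N.+1).+1 = (2 * N).+3 by lia.
have e1 : (2 * N).+2%:Z - N.+1%:Z = N.+1 by lia.
have e2 (i : nat) : i.+1%:Z - N.+1%:Z = i%:Z - N%:Z by lia.
have e3 : (2 * N).+1%:Z - N.+1%:Z = N by lia.
have e4 (i : nat) : i%:Z - N.+1%:Z = i%:Z - N%:Z - 1 by lia.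
(* The step at n also involves n - 1, which goes down to -N - 1; S_(N+1)(A; C) being defined covers
   that range. *)
have bnd (i : nat) : (i < (2 * N).+1)%N ->
    (- N.+1%:Z <= i%:Z - N%:Z <= N.+1) && (- N.+1%:Z <= i%:Z - N%:Z - 1 <= N.+1).
  by lia.
have b1 : - N.+1%:Z <= -1 <= N.+1%:Z by lia.
have b2 : - N.+1%:Z <= - N.+1%:Z <= N.+1%:Z by lia.
have q0 : q != 0 by case/andP: hq => h _; rewrite -normr_gt0.
case: hS1 => v0 hS1; case: hS2 => v1 _; case: hK => k1 k2 k3.
(* Read off at index -1, where the denominator of (bq/A; q)_(-1) is exactly 1 - b/A. *)
have low (b : R[i]) : b * q / A \in truncS_lower q B D E A C -> 1 - b / A != 0.
  move=> hb; have [/(_ (b * q / A)) h _] := hS1 _ b1.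
  have := h; rewrite mem_cat hb orbT => /(_ isT).
  by rewrite /= big_ord1 expr1 mulrAC mulfK.
have hv : nablas [:: B * D * E / A; B * D / A; B * E / A; D * E / A] != 0.
  rewrite /nablas !big_cons big_nil mulr1 !mulf_neq0 //.
  (* The leading denominator of S_N(Aq; Cq) is 1 - BDEq/(Aq) = 1 - BDE/A. *)
  - by move: v1; rewrite -mulf_div divff // mulr1.
  - by apply: low; rewrite !inE eqxx !orbT.
  - by apply: low; rewrite !inE eqxx !orbT.
  - by apply: low; rewrite !inE eqxx.
have hneg : forall x, x \in truncS_upper q B D E A C ++ truncS_lower q B D E A C ->
    qfact_den q x (- N.+1%:Z) != 0 by have [] := hS1 _ b2.
have tele : truncS q B D E N A C
    - contiguity_coef q A B C D E * truncS q B D E N (A * q) (C * q)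
    = primitive q A B C D E (- N.+1%:Z) - primitive q A B C D E N.
  rewrite /truncS mulr_sumr -sumrB.
  rewrite -(big_mkord xpredT (fun i => truncS_term q B D E A C (i%:Z - N%:Z)
    - contiguity_coef q A B C D E
      * truncS_term q B D E (A * q) (C * q) (i%:Z - N%:Z))).
  (* Here i = n + N, so the summand H_(n-1) - H_n is the increment from i to i + 1 of -
     H_(i-N-1). *)
  rewrite (telescope_sumr_eq (fun i => - primitive q A B C D E (i%:Z - N.+1%:Z))) //.
    by rewrite e3 sub0r opprK addrC.
  move=> i /= /bnd /andP[hi hi1]; rewrite opprK [RHS]addrC e2 e4.
  have [d1 z1] := hS1 _ hi; have [d2 z2] := hS1 _ hi1.
  by apply: truncS_term_telescope => // x hx; split; [apply: d2 | apply: d1].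
have split : truncS q B D E N.+1 A C = truncS_term q B D E A C (- N.+1%:Z)
    + truncS q B D E N A C + truncS_term q B D E A C N.+1.
  rewrite /truncS e0 big_ord_recl big_ord_recr /= sub0r addrA; congr (_ + _ + _).
    by apply: eq_bigr => i _; rewrite -e2.
  by rewrite /bump /= e1.
rewrite split -[truncS q B D E N A C](subrK (contiguity_coef q A B C D E
  * truncS q B D E N (A * q) (C * q))) tele.
rewrite -/(contiguity_coef q A B C D E) /K !mulrDl mulNr.
rewrite -(truncS_term_K q0 hC k1) -(boundary_term q0 hA hB hC hD hE hneg k2).
rewrite -primitive_K; ring.
Qed.
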